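(* Let $\mathcal{F}$ be the class of all fractional summable functions $f:U\to\mathbb{C}$ (with arbitrary domains $U\subset\mathbb{C}$ and of arbitrary degree $\sigma\in\mathbb{N}\cup\{-\infty\}$). The assignment that sends $f:U\to\mathbb{C}$ in $\mathcal{F}$ and $x,y\in\mathbb{C}$ with $x,y+1\in U$ to the fractional sum of $f$ from $x$ to $y$ satisfies all the axioms (S1), (S2), (S3), (S4), (S5) and (S6). Moreover, it is the unique summation on $\mathcal{F}$ with this property: every summation on $\mathcal{F}$ satisfying (S1)--(S6) assigns to every $f:U\to\mathbb{C}$ in $\mathcal{F}$ and all $x,y\in\mathbb{C}$ with $x,y+1\in U$ the fractional sum of $f$ from $x$ to $y$.
   Context: Conventions: $\mathbb{N}=\{0,1,2,\dots\}$; the zero polynomial is the unique polynomial of degree $-\infty$; polynomials have complex coefficients and are regarded as functions $\mathbb{C}\to\mathbb{C}$. Sums of polynomials: for a polynomial $p$ let $P$ be the unique polynomial with $P(0)=0$ and $P(z)-P(z-1)=p(z)$ for all $z\in\mathbb{C}$; for $x,y\in\mathbb{C}$ put $S_x^y(p):=P(y)-P(x-1)$. Fractional summable functions: let $U\subset\mathbb{C}$ and $\sigma\in\mathbb{N}\cup\{-\infty\}$. A function $f:U\to\mathbb{C}$ is fractional summable of degree $\sigma$ if (i) $x+1\in U$ for all $x\in U$; (ii) there is a sequence of polynomials $(p_n)_{n\in\mathbb{N}}$ of fixed degree $\sigma$ such that $|f(n+x)-p_n(n+x)|\to 0$ as $n\to+\infty$ for all $x\in U$; (iii) for all $x,y+1\in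 U$ the limit $$\lim_{n\to\infty}\left(S_{n+x}^{n+y}(p_n)+\sum_{\nu=1}^n\bigl(f(\nu+x-1)-f(\nu+y)\bigr)\right)$$ exists. In this case the limit in (iii), which does not depend on the choice of the approximating polynomials $(p_n)$, is called the fractional sum of $f$ from $x$ to $y$. Every polynomial, as a function on $U=\mathbb{C}$, is fractional summable, and its fractional sum from $x$ to $y$ is $S_x^y(p)$. A summation on $\mathcal{F}$ is an assignment of a complex number, denoted $\sum_{\nu=x}^y f(\nu)$, to every $f:U\to\mathbb{C}$ in $\mathcal{F}$ and all $x,y\in\mathbb{C}$ with $x,y+1\in U$. For $s\in\mathbb{C}$ and $f:U\to\mathbb{C}$, the function $\nu\mapsto f(\nu+s)$ has domain $U-s=\{u-s:u\in U\}$. The axioms for a summation on $\mathcal{F}$ are, for $f:U\to\mathbb{C}$ and $g:U\to\mathbb{C}$ in $\mathcal{F}$: (S1) Continued summation: $\sum_{\nu=x}^y f(\nu)+\sum_{\nu=y+1}^z f(\nu)=\sum_{\nu=x}^z f(\nu)$ whenever $x,y+1,z+1\in U$. (S2) Translation invariance: $\sum_{\nu=x+s}^{y+s} f(\nu)=\sum_{\nu=x}^y f(\nu+s)$ whenever $s\in\mathbb{C}$ and $x+s,y+s+1\in U$. (S3) Linearity: $\sum_{\nu=x}^y(\lambda f(\nu)+\mu g(\nu))=\lambda\sum_{\nu=x}^y f(\nu)+\mu\sum_{\nu=x}^y g(\nu)$ for all $\lambda,\mu\in\mathbb{C}$ and $x,y+1\in U$ (in particular $\lambda f+\mu g\in\mathcal{F}$).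 (S4) Consistency with the classical definition: $\sum_{\nu=1}^1 f(\nu)=f(1)$ if $1\in U$. (S5) Monomials: for every $d\in\mathbb{N}$, the map $z\mapsto\sum_{\nu=1}^z\nu^d$ is holomorphic in $\mathbb{C}$ (here $\nu\mapsto\nu^d$ has domain $\mathbb{C}$). (S6) Right shift continuity: if $\lim_{n\to+\infty}f(z+n)=0$ for every $z\in U$, then $\lim_{n\to+\infty}\sum_{\nu=x}^y f(\nu+n)=0$ for all $x,y+1\in U$; more generally, if $(p_n)_{n\in\mathbb{N}}$ is a sequence of polynomials of fixed degree such that $|f(z+n)-p_n(z+n)|\to0$ as $n\to+\infty$ for all $z\in U$, then $\left|\sum_{\nu=x}^y f(\nu+n)-\sum_{\nu=x}^y p_n(\nu+n)\right|\to 0$ as $n\to+\infty$ for all $x,y+1\in U$ (here the $p_n$ are functions with domain $\mathbb{C}$). *)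

(* Defs.v *)
From HB Require Import structures.
From mathcomp Require Import all_boot all_order all_algebra complex.
From mathcomp Require Import all_classical all_reals all_analysis.

Set Implicit Arguments.
Unset Strict Implicit.
Unset Printing Implicit Defensive.

Import Order.TTheory GRing.Theory Num.Theory.
Import numFieldNormedType.Exports.

Local Open Scope classical_set_scope.
Local Open Scope ring_scope.
Local Open Scope complex_scope.

(* R[i] seen as a numFieldType, through which it inherits its metric topology
   and its structure of normed module over itself. *)
Definition Cplx (R : realType) : numFieldType := R[i].

(* A function f : U -> C with U a subset of C is a function on the subtype
   associated with U; 'valL_0 f is its extension by 0 to C, which is only ever
   evaluated at points of U below, and sigL U g is the restriction to U of
   g : C -> C. *)

Section PolynomialSums.
Variable R : realType.
Local Notation C := (Cplx R).

Definition poly_antidiff (p : {poly C}) : {poly C} :=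
  xget 0 [set P : {poly C} |
    P.[0] = 0 /\ forall z : C, P.[z] - P.[z - 1] = p.[z]].

Definition poly_sum (p : {poly C}) (x y : C) : C :=
  (poly_antidiff p).[y] - (poly_antidiff p).[x - 1].

End PolynomialSums.

Section FractionalSums.
Variable R : realType.
Local Notation C := (Cplx R).

(* A degree sigma in N or -oo is encoded by k = size p, i.e., k = sigma + 1 for
   sigma in N and k = 0 for sigma = -oo. *)
Definition approximates (k : nat) (p : nat -> {poly C}) (U : set C)
    (f : U -> C) : Prop :=
  (forall n, size (p n) = k) /\
  (forall x, U x ->
    `|'valL_0 f (n%:R + x) - (p n).[n%:R + x]| @[n --> \oo] --> (0 : C)).

Definition fractional_sum_seq (p : nat -> {poly C}) (U : set C) (f : U -> C)
    (x y : C) (n : nat) : C :=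
  poly_sum (p n) (n%:R + x) (n%:R + y) +
  \sum_(1 <= v < n.+1) ('valL_0 f (v%:R + x - 1) - 'valL_0 f (v%:R + y)).

Definition fractional_summable_of_degree (k : nat) (U : set C) (f : U -> C) :
    Prop :=
  (forall x, U x -> U (x + 1)) /\
  exists p : nat -> {poly C},
    approximates k p f /\
    (forall x y, U x -> U (y + 1) ->
      cvg (fractional_sum_seq p f x y n @[n --> \oo])).

Definition fractional_summable (U : set C) (f : U -> C) : Prop :=
  exists k, fractional_summable_of_degree k f.

(* The limit does not depend on the approximating sequence p, so this set of
   limits is a singleton when f is fractional summable and U contains x and
   y + 1. *)
Definition fractional_sum (U : set C) (f : U -> C) (x y : C) : C :=
  get [set l : C | exists k p,
    approximates k p f /\
    fractional_sum_seq p f x y n @[n --> \oo] --> l].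

End FractionalSums.

Section Summations.
Variable R : realType.
Local Notation C := (Cplx R).

Definition function_class := forall U : set C, (U -> C) -> Prop.

(* A summation on a class F gives sums only for f : U -> C in F and x, y with
   x and y + 1 in U; here it is a total function, whose values on other
   arguments are junk that the axioms below never constrain. *)
Definition summation := forall U : set C, (U -> C) -> C -> C -> C.

Definition shift_dom (s : C) (U : set C) : set C := [set z | U (z + s)].

Definition shift_fun (s : C) (U : set C) (f : U -> C) : shift_dom s U -> C :=
  sigL (shift_dom s U) (fun z => 'valL_0 f (z + s)).
Arguments shift_fun s [U] f.

(* Translation invariance and linearity require F to be closed under the
   operations whose results they sum; together with the membership of the
   monomials, this puts in F all functions summed in these axioms. *)
Record summation_axioms (F : function_class) (S : summation) : Prop := {
  continued_summation : forall (U : set C) (f : U -> C), F U f ->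
    forall x y z, U x -> U (y + 1) -> U (z + 1) ->
      S U f x y + S U f (y + 1) z = S U f x z;
  translation_invariance : forall (U : set C) (f : U -> C), F U f ->
    forall s, F (shift_dom s U) (shift_fun s f) /\
      forall x y, U (x + s) -> U (y + s + 1) ->
        S U f (x + s) (y + s) = S (shift_dom s U) (shift_fun s f) x y;
  linearity : forall (U : set C) (f g : U -> C), F U f -> F U g ->
    forall l m : C, F U (fun u => l * f u + m * g u) /\
      forall x y, U x -> U (y + 1) ->
        S U (fun u => l * f u + m * g u) x y = l * S U f x y + m * S U g x y;
  classical_consistency : forall (U : set C) (f : U -> C), F U f ->
    U 1 -> S U f 1 1 = 'valL_0 f 1;
  (* derivability over the field C in direction 1 is complex
     differentiability *)
  holomorphic_monomials : forall d : nat,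
    F setT (sigL setT (fun z => z ^+ d)) /\
    forall z, derivable (S setT (sigL setT (fun z => z ^+ d)) 1 : C -> C) z 1;
  right_shift_continuity0 : forall (U : set C) (f : U -> C), F U f ->
    (forall z, U z -> 'valL_0 f (z + n%:R) @[n --> \oo] --> (0 : C)) ->
    forall x y, U x -> U (y + 1) ->
      S (shift_dom n%:R U) (shift_fun n%:R f) x y @[n --> \oo] --> (0 : C);
  right_shift_continuity : forall (U : set C) (f : U -> C), F U f ->
    forall (k : nat) (p : nat -> {poly C}), (forall n, size (p n) = k) ->
    (forall z, U z ->
      `|'valL_0 f (z + n%:R) - (p n).[z + n%:R]| @[n --> \oo] --> (0 : C)) ->
    forall x y, U x -> U (y + 1) ->
      `|S (shift_dom n%:R U) (shift_fun n%:R f) x y -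
        S setT (sigL setT (fun z => (p n).[z + n%:R])) x y|
        @[n --> \oo] --> (0 : C)
}.

End Summations.

(* Main.v *)
Require Import Defs.
From HB Require Import structures.
From mathcomp Require Import all_boot all_order all_algebra complex.
From mathcomp Require Import all_classical all_reals all_analysis.
From mathcomp Require Import ring.

Set Implicit Arguments.
Unset Strict Implicit.
Unset Printing Implicit Defensive.

Import Order.TTheory GRing.Theory Num.Theory.
Import numFieldNormedType.Exports.

Local Open Scope classical_set_scope.
Local Open Scope ring_scope.

(** Everything rests on one finite-dimensional fact. On polynomials of bounded
    size k the sum from x to x + w is a fixed linear combination, with
    coefficients depending only on k and w, of the values at x, x + 1, ...,
    x + (k - 1) ([poly_sum_interpolation], by Lagrange interpolation). So if
    polynomials q_n of bounded size satisfy q_n(n + x) --> 0 at all points x of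
    an orbit of the translation by 1, then their sums from n + x to n + y tend
    to 0 ([poly_sum_cvg0]). Applied to the difference of two approximating
    sequences of f, this shows that the sequences defining the fractional sum
    have the same limit ([fractional_sum_seq_cvg]).

    It also allows to relax the condition that all the approximating
    polynomials have the same degree to a bound on the degree
    ([fractional_summable_le]). This matters for linearity: the degrees of
    a p_n + b q_n may drop irregularly, because of cancellations of leading
    terms. Adding a small multiple of (X - n)^(k-1) to the n-th polynomial
    whenever its degree drops restores a constant degree, and the limits do not
    change by the previous paragraph.

    Continued summation, translation invariance and linearity then hold already
    for the sequences, term by term. The sum from x to x is f(x) because the
    finite sums telescope. Together with continued summation this gives, by
    induction on n ([shift_decomposition]),
      sum_x^y f = sum_(n+x)^(n+y) f + sum_(v=1)^n (f(v+x-1) - f(v+y)),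
    so right shift continuity amounts to the convergence that defines the
    fractional sum. On polynomials the same identity shows that the defining
    sequence is constant, equal to the polynomial sum.

    For uniqueness, a summation S satisfying the axioms has the sum from x to x
    equal to f(x) and so satisfies the same decomposition; right shift
    continuity then reduces S to its values on polynomials. For these, by
    induction on the degree d, the difference h(z) between the two sums of X^d
    from 1 to z is additive in z: translating X^d by a only adds terms of lower
    degree, on which both summations agree. An additive function which is
    complex differentiable at 0 is linear, and h(1) = 0, so h = 0
    ([additive_derivable_eq0], [summation_poly]). *)

(** * Antidifferences of polynomials *)

Lemma poly_eq_nat (F : numDomainType) (p q : {poly F}) :
  (forall n : nat, p.[n%:R] = q.[n%:R]) -> p = q.
Proof.
move=> pq; apply/eqP; rewrite -subr_eq0; apply: contraT => nz.
pose s := [seq (n%:R : F) | n <- iota 0 (size (p - q))].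
have us : uniq s by rewrite map_inj_uniq ?iota_uniq //; exact: mulrIn.
have /(max_poly_roots nz)/(_ us) : all (root (p - q)) s.
  by apply/allP => _ /mapP[n _ ->]; rewrite rootE hornerD hornerN pq subrr.
by rewrite size_map size_iota ltnn.
Qed.

Lemma size_sub_monic (F : nzRingType) (d : nat) (p q : {poly F}) :
  p \is monic -> q \is monic -> size p = d.+1 -> size q = d.+1 ->
  (size (p - q)%R <= d)%N.
Proof.
move=> /monicP pm /monicP qm sp sq; apply/leq_sizeP => j dj.
rewrite coefB; move: dj; rewrite leq_eqVlt => /predU1P[<-|dj].
  by move: pm qm; rewrite /lead_coef sp sq /= => -> ->; rewrite subrr.
by rewrite !nth_default ?subrr ?sp ?sq.
Qed.

Lemma size_sub_lead (F : nzRingType) (d : nat) (p q : {poly F}) :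
  (size p <= d.+1)%N -> q \is monic -> size q = d.+1 ->
  (size (p - p`_d *: q)%R <= d)%N.
Proof.
move=> sp /monicP qm sq; apply/leq_sizeP => j dj.
rewrite coefB coefZ; move: dj; rewrite leq_eqVlt => /predU1P[<-|dj].
  by move: qm; rewrite /lead_coef sq /= => ->; rewrite mulr1 subrr.
rewrite [p`_j]nth_default ?(leq_trans sp) // [q`_j]nth_default ?sq //.
by rewrite mulr0 subrr.
Qed.

(** The rising factorials are a basis on which the backward difference is
    explicit: it sends the one of degree d + 1 to d + 1 times the one of degree
    d. Antidifferences thus exist by elimination of leading terms. *)
Definition rising (F : nzRingType) (d : nat) : {poly F} :=
  \prod_(i < d) ('X - (- i%:R)%:P).

Lemma rising_diff (F : comNzRingType) (d : nat) (z : F) :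
  (rising F d.+1).[z] - (rising F d.+1).[z - 1] = d.+1%:R * (rising F d).[z].
Proof.
have E n t : (rising F n).[t] = \prod_(i < n) (t + i%:R).
  by rewrite horner_prod; apply: eq_bigr => i _; rewrite hornerXsubC opprK.
rewrite !E big_ord_recr [X in _ - X]big_ord_recl /= addr0.
have -> : \prod_(i < d) (z - 1 + (bump 0 i)%:R) = \prod_(i < d) (z + i%:R).
  by apply: eq_bigr => i _; rewrite /bump /= natrD addrA subrK.
by rewrite -[d.+1%:R]natr1; ring.
Qed.

Lemma antidiff_exists (F : numFieldType) (p : {poly F}) :
  exists P : {poly F}, P.[0] = 0 /\ forall z, P.[z] - P.[z - 1] = p.[z].
Proof.
have [k] := ubnP (size p); elim: k => // k IH in p *; rewrite ltnS => sp.
case: k => [|k] in IH sp *.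
  exists 0; move: sp; rewrite leqn0 size_poly_eq0 => /eqP ->.
  by split=> [|z]; rewrite !horner0 ?subrr.
have mon : rising F k \is monic by exact: monic_prod_XsubC.
have sr : size (rising F k) = k.+1.
  by rewrite size_prod_XsubC /index_enum -enumT size_enum_ord.
have [Q [Q0 dQ]] := IH _ (size_sub_lead sp mon sr).
exists (Q + (p`_k / k.+1%:R) *: rising F k.+1); split=> [|z].
  rewrite !hornerE Q0 add0r /rising big_ord_recl hornerM hornerXsubC.
  by rewrite opprK addr0 mul0r mulr0.
rewrite !hornerD !hornerZ.
rewrite [LHS](_ : _ = (Q.[z] - Q.[z - 1]) + p`_k / k.+1%:R *
  ((rising F k.+1).[z] - (rising F k.+1).[z - 1])); last by ring.
rewrite dQ rising_diff hornerD hornerN hornerZ mulrA divfK ?pnatr_eq0 //.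
by rewrite subrK.
Qed.

(** Antidifferences with the same initial value agree at the natural numbers, by
    induction, and these are infinitely many points. *)
Lemma antidiff_unique (F : numDomainType) (P Q : {poly F}) :
  P.[0] = Q.[0] -> (forall z, P.[z] - P.[z - 1] = Q.[z] - Q.[z - 1]) -> P = Q.
Proof.
move=> PQ0 PQ; apply: poly_eq_nat; elim=> // n IH.
by have := PQ n.+1%:R; rewrite -[in _ - 1]natr1 addrK IH => /addIr.
Qed.

Section PolySum.
Variable R : realType.
Local Notation C := (Cplx R).
Implicit Types (p q : {poly C}) (x y z : C).

Lemma poly_antidiffP p : (poly_antidiff p).[0] = 0 /\
  forall z, (poly_antidiff p).[z] - (poly_antidiff p).[z - 1] = p.[z].
Proof.
exact: (xgetPex 0 (antidiff_exists p)).
Qed.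

(** Any antidifference computes the sum, since the normalization at 0 cancels
    out. *)
Lemma poly_sum_antidiff p (P : {poly C}) x y :
  (forall z, P.[z] - P.[z - 1] = p.[z]) -> poly_sum p x y = P.[y] - P.[x - 1].
Proof.
move=> dP; have [A0 dA] := poly_antidiffP p.
have -> : P = poly_antidiff p + P.[0]%:P.
  apply: antidiff_unique => [|z]; first by rewrite hornerD A0 hornerC add0r.
  by rewrite dP !hornerD !hornerC opprD addrACA dA subrr addr0.
by rewrite /poly_sum !hornerD !hornerC opprD addrACA subrr addr0.
Qed.

Lemma poly_sum_lin p q (a b : C) x y :
  poly_sum (a *: p + b *: q) x y = a * poly_sum p x y + b * poly_sum q x y.
Proof.
have [_ dp] := poly_antidiffP p; have [_ dq] := poly_antidiffP q.
rewrite (@poly_sum_antidiff _ (a *: poly_antidiff p + b *: poly_antidiff q)).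
  by rewrite /poly_sum !hornerE; ring.
by move=> z; rewrite !hornerD !hornerZ -dp -dq; ring.
Qed.

Lemma poly_sum0 x y : poly_sum 0 x y = 0.
Proof.
by have := poly_sum_lin 0 0 0 0 x y; rewrite !scale0r addr0 !mul0r addr0.
Qed.

Lemma poly_sumZ p (a : C) x y : poly_sum (a *: p) x y = a * poly_sum p x y.
Proof.
by have := poly_sum_lin p 0 a 0 x y; rewrite scale0r addr0 mul0r addr0.
Qed.

Lemma poly_sumD p q x y :
  poly_sum (p + q) x y = poly_sum p x y + poly_sum q x y.
Proof. by have := poly_sum_lin p q 1 1 x y; rewrite !scale1r !mul1r. Qed.

Lemma poly_sum_shift p (s : C) x y :
  poly_sum (p \Po ('X + s%:P)) x y = poly_sum p (x + s) (y + s).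
Proof.
have [_ dp] := poly_antidiffP p.
rewrite (@poly_sum_antidiff _ (poly_antidiff p \Po ('X + s%:P))).
  by rewrite /poly_sum !horner_comp !hornerE; congr (_ - _.[_]); ring.
move=> z; rewrite !horner_comp !hornerE -dp.
by congr (_ - _.[_]); ring.
Qed.

Lemma poly_sum_diag p x : poly_sum p x x = p.[x].
Proof. by rewrite /poly_sum (poly_antidiffP p).2. Qed.

Lemma poly_sum_cat p x y z :
  poly_sum p x y + poly_sum p (y + 1) z = poly_sum p x z.
Proof. by rewrite /poly_sum addrK; ring. Qed.

(** The coefficients are the sums from 0 to w of the Lagrange polynomials of the
    nodes 0, ..., k - 1, as p is determined by its values at the corresponding
    translated nodes. That they do not depend on p nor on x is what makes the
    sum continuous for pointwise convergence, uniformly along the orbit of x. *)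
Lemma poly_sum_interpolation (k : nat) (w : C) : exists c : nat -> C,
  forall p x, (size p <= k)%N ->
    poly_sum p x (x + w) = \sum_(j < k) p.[x + j%:R] * c j.
Proof.
case: k => [|k].
  exists (fun=> 0) => p x; rewrite leqn0 size_poly_eq0 => /eqP ->.
  by rewrite big_ord0 poly_sum0.
pose u (n : nat) : C := n%:R.
have inju : injective u by exact: mulrIn.
pose L (j : 'I_k.+1) : {poly C} := tnth (lagrange k.+1 u) j.
exists (fun j => poly_sum (L (inord j)) 0 w) => p x sp.
have -> : poly_sum p x (x + w) = poly_sum (p \Po ('X + x%:P)) 0 w.
  by rewrite poly_sum_shift add0r [w + x]addrC.
set q := _ \Po _.
have sq : (size q <= k.+1)%N by rewrite size_comp_poly2 ?size_XaddC.
rewrite [q](lagrange_gen (ltn0Sn k) inju sq).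
rewrite (big_morph _ (fun r t => poly_sumD r t 0 w) (poly_sum0 0 w)).
apply: eq_bigr => i _; rewrite inord_val mul_polyC poly_sumZ.
by rewrite /q horner_comp hornerD hornerX hornerC addrC.
Qed.

End PolySum.

(** * Restrictions to a subset *)

Section Restriction.
Variables (T V : Type) (v : V) (U : set T).

Lemma valL_val (f : U -> V) (u : U) : 'valL_v f (set_val u) = f u.
Proof. by rewrite -[in RHS](valLK v f). Qed.

(** A single u serves all functions, so an equation between the values of
    several extended functions at z becomes one in a point of U. *)
Lemma valLP (z : T) : U z ->
  exists2 u : U, z = set_val u & forall f : U -> V, 'valL_v f z = f u.
Proof.
move=> Uz; have zu : z = set_val (SigSub (mem_set Uz) : U) by rewrite set_valE.
by exists (SigSub (mem_set Uz)) => // f; rewrite [in LHS]zu valL_val.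
Qed.

Lemma valL_sigL (g : T -> V) (z : T) : U z -> 'valL_v (sigL U g) z = g z.
Proof. by case/valLP => u -> ->. Qed.

End Restriction.

(** * Approximation by polynomials of bounded degree *)

Section Approximation.
Variable R : realType.
Local Notation C := (Cplx R).
Implicit Types (p q : nat -> {poly C}) (x y z : C) (U : set C).

Lemma eq_seq_cvg (u v : nat -> C) (l : C) : (forall n, u n = v n) ->
  v n @[n --> \oo] --> l -> u n @[n --> \oo] --> l.
Proof. by move=> /funext ->. Qed.

(** Positive complex numbers are real, so this reduces to the archimedean
    property of R. *)
Lemma Cplx_cvg_harmonic : (n.+1%:R^-1 : C) @[n --> \oo] --> (0 : C).
Proof.
apply/cvgr0Pnorm_lt => e e0.
have er : e = (complex.Re e)%:C%C by rewrite RRe_real // gtr0_real.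
have r0 : 0 < complex.Re e by move: e0; rewrite er ltcR.
have /cvgr0Pnorm_lt/(_ _ r0) := @cvg_harmonic R.
apply: filterS => n; rewrite /harmonic /=.
rewrite !ger0_norm ?invr_ge0 ?ler0n // => h.
by rewrite er -(rmorph_nat (real_complex R)) -fmorphV ltcR.
Qed.

(** Bounding the size, instead of fixing it, makes these sequences stable by
    linear combinations. *)
Definition approximates_le (k : nat) p U (f : U -> C) : Prop :=
  (forall n, (size (p n) <= k)%N) /\
  forall x, U x ->
    'valL_0 f (n%:R + x) - (p n).[n%:R + x] @[n --> \oo] --> (0 : C).

Lemma approximatesW (k : nat) p U (f : U -> C) :
  approximates k p f -> approximates_le k p f.
Proof.
by case=> sp pf; split=> [n|x Ux]; [rewrite sp | apply/norm_cvg0P/pf].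
Qed.

Lemma closed_addn U : (forall x, U x -> U (x + 1)) ->
  forall x (n : nat), U x -> U (n%:R + x).
Proof.
move=> clU x n Ux; elim: n => [|n IH]; first by rewrite add0r.
by rewrite -natr1 addrAC; exact: clU.
Qed.

Lemma closed_addn_sub1 U : (forall x, U x -> U (x + 1)) ->
  forall x (v : nat), (0 < v)%N -> U x -> U (v%:R + x - 1).
Proof.
move=> clU x [//|v] _ Ux; rewrite -natr1 addrAC addrK; exact: closed_addn.
Qed.

Lemma closed_addn_pred U : (forall x, U x -> U (x + 1)) ->
  forall y (v : nat), (0 < v)%N -> U (y + 1) -> U (v%:R + y).
Proof.
move=> clU y v v0 Uy; rewrite -[y](addrK 1) addrA.
exact: closed_addn_sub1.
Qed.

Lemma poly_sum_cvg0 (k : nat) q x y : (forall n, (size (q n) <= k)%N) ->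
  (forall j : nat, (q n).[n%:R + (x + j%:R)] @[n --> \oo] --> (0 : C)) ->
  poly_sum (q n) (n%:R + x) (n%:R + y) @[n --> \oo] --> (0 : C).
Proof.
move=> sq q0; have [c cE] := poly_sum_interpolation k (y - x).
rewrite (_ : (fun n => _) =
    (fun n => \sum_(j < k) (q n).[n%:R + (x + j%:R)] * c j)).
  rewrite -[X in _ --> X](_ : \sum_(j < k) (0 * c j) = 0).
    apply: cvg_big => [|j _]; first exact: add_continuous.
    by apply: cvgMr_tmp; exact: q0.
  by rewrite big1 // => j _; rewrite mul0r.
apply/funext => n.
rewrite -[n%:R + y](_ : n%:R + x + (y - x) = _); last by ring.
by rewrite cE //; apply: eq_bigr => j _; rewrite addrA.
Qed.

(** Two approximations of f may have different sizes, but their difference has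
    bounded size and tends to 0 along the orbit of x, and the finite sums of
    values of f cancel out. *)
Lemma fractional_sum_seq_indep (k k' : nat) p q U (f : U -> C) :
  approximates_le k p f -> approximates_le k' q f ->
  (forall x, U x -> U (x + 1)) -> forall x y, U x ->
  fractional_sum_seq p f x y n - fractional_sum_seq q f x y n
    @[n --> \oo] --> (0 : C).
Proof.
move=> [sp pf] [sq qf] clU x y Ux.
rewrite (_ : (fun n => _) =
    (fun n => poly_sum (p n - q n) (n%:R + x) (n%:R + y))); last first.
  apply/funext => n; rewrite /fractional_sum_seq.
  have := poly_sum_lin (p n) (q n) 1 (-1) (n%:R + x) (n%:R + y).
  by rewrite scale1r scaleN1r => ->; ring.
apply: (@poly_sum_cvg0 (maxn k k')) => [n|j].
  apply: leq_trans (size_polyD _ _) _; rewrite size_polyN.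
  by rewrite geq_max !leq_max sp sq orbT.
have Uxj : U (x + j%:R) by rewrite addrC; exact: closed_addn.
have := cvgB (qf _ Uxj) (pf _ Uxj); rewrite subrr.
by move=> /(_ _)/eq_seq_cvg; apply => n; rewrite hornerD hornerN !fctE; ring.
Qed.

(** This identifies the fractional sum, defined by a choice, with the limit
    along any approximating sequence. *)
Lemma fractional_sum_seq_cvg (k : nat) p U (f : U -> C) x y :
  fractional_summable f -> approximates_le k p f -> U x -> U (y + 1) ->
  fractional_sum_seq p f x y n @[n --> \oo] --> fractional_sum f x y.
Proof.
move=> [k0 [clU [p0 [p0f cv]]]] pf Ux Uy.
have main (k1 : nat) q : approximates_le k1 q f ->
  fractional_sum_seq q f x y n @[n --> \oo] -->
    lim (fractional_sum_seq p0 f x y n @[n --> \oo]).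
  move=> qf.
  have := cvgD (fractional_sum_seq_indep qf (approximatesW p0f) clU y Ux)
               (cv x y Ux Uy).
  by rewrite add0r; move=> /(_ _)/eq_seq_cvg; apply => n; rewrite [RHS]subrK.
suff -> : fractional_sum f x y =
    lim (fractional_sum_seq p0 f x y n @[n --> \oo]).
  exact: main pf.
rewrite /fractional_sum.
set A := [set l | _].
have [k1 [q [qf ql]]] : A (get A).
  apply: getPex; exists (lim (fractional_sum_seq p0 f x y n @[n --> \oo])).
  by exists k0, p0; split => //; exact: cv.
have := cvg_lim (@norm_hausdorff _ C) (main _ _ (approximatesW qf)) => <-.
exact: esym (cvg_lim (@norm_hausdorff _ C) ql).
Qed.

(** To restore a constant size k + 1, the n-th polynomial is perturbed by
    (X - n)^k / (n + 1) exactly when its coefficient of degree k vanishes. The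
    centre n makes the value of the perturbation at n + x equal to
    x^k / (n + 1), which tends to 0 for every x. *)
Lemma fractional_summable_le (k : nat) p U (f : U -> C) :
  (forall x, U x -> U (x + 1)) -> approximates_le k p f ->
  (forall x y, U x -> U (y + 1) ->
     cvg (fractional_sum_seq p f x y n @[n --> \oo])) ->
  fractional_summable f.
Proof.
move=> clU pf cv.
suff [q qf] : exists q, approximates k q f.
  exists k; split; first exact: clU.
  exists q; split; first exact: qf.
  move=> x y Ux Uy.
  apply/cvg_ex; exists (0 + lim (fractional_sum_seq p f x y n @[n --> \oo])).
  have := cvgD (fractional_sum_seq_indep (approximatesW qf) pf clU y Ux)
               (cv x y Ux Uy).
  by move=> /(_ _)/eq_seq_cvg; apply => n; rewrite [RHS]subrK.
case: k pf => [|k] [sp pf].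
  exists p; split=> [n|x Ux]; last exact/norm_cvg0P/pf.
  by apply/eqP; rewrite -leqn0.
pose d n : C := if (p n)`_k == 0 then n.+1%:R^-1 else 0.
have d0 : d n @[n --> \oo] --> (0 : C).
  apply/cvgr0Pnorm_lt => e e0.
  have /cvgr0Pnorm_lt/(_ _ e0) := Cplx_cvg_harmonic.
  by apply: filterS => n; rewrite /d; case: ifP; rewrite ?normr0.
have monX n : ('X - n%:R%:P : {poly C}) ^+ k \is monic.
  by rewrite monic_exp // monicXsubC.
have sizeX n : size (('X - n%:R%:P : {poly C}) ^+ k) = k.+1.
  by rewrite size_exp_XsubC.
exists (fun n => p n + d n *: ('X - n%:R%:P) ^+ k); split=> [n|x Ux].
  apply/eqP; rewrite eqn_leq; apply/andP; split.
    apply: leq_trans (size_polyD _ _) _; rewrite geq_max sp /=.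
    by apply: leq_trans (size_scale_leq _ _) _; rewrite sizeX.
  have ck : (('X - n%:R%:P : {poly C}) ^+ k)`_k = 1.
    by have /monicP := monX n; rewrite /lead_coef sizeX.
  rewrite ltnNge; apply/negP => /leq_sizeP/(_ _ (leqnn k)).
  rewrite coefD coefZ ck mulr1 /d; have [->|nz] := eqVneq (p n)`_k 0.
    by rewrite add0r => /eqP; rewrite invr_eq0 pnatr_eq0.
  by rewrite addr0 => /eqP; rewrite (negbTE nz).
apply/norm_cvg0P.
have dx : d n * x ^+ k @[n --> \oo] --> (0 : C).
  by rewrite -[X in _ --> X](mul0r (x ^+ k)); apply: cvgMr_tmp.
have := cvgB (pf x Ux) dx; rewrite subr0.
move=> /(_ _)/eq_seq_cvg; apply => n.
rewrite !fctE hornerD hornerZ horner_exp hornerXsubC [n%:R + x - _]addrAC.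
by rewrite subrr add0r opprD addrA.
Qed.

End Approximation.

(** * Consequences of continued summation *)

Section Decomposition.
Variable R : realType.
Local Notation C := (Cplx R).
Implicit Types (x y z : C) (U V : set C).

(** This only uses continued summation and the value of one-term sums, so it
    applies to polynomial sums, to fractional sums, and to an unknown
    summation. *)
Lemma shift_decomposition (T : C -> C -> C) (g : C -> C) U :
  (forall x, U x -> U (x + 1)) ->
  (forall x y z, U x -> U (y + 1) -> U (z + 1) ->
    T x y + T (y + 1) z = T x z) ->
  (forall x, U x -> T x x = g x) ->
  forall x y (n : nat), U x -> U (y + 1) ->
    T x y = T (n%:R + x) (n%:R + y) +
      \sum_(1 <= v < n.+1) (g (v%:R + x - 1) - g (v%:R + y)).
Proof.
move=> clU catT diagT x y n Ux Uy; elim: n => [|n ->].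
  by rewrite big_nil !add0r addr0.
rewrite [in RHS]big_nat_recr //= [RHS]addrCA [LHS]addrC; congr (_ + _).
have Unx : U (n%:R + x) by exact: closed_addn.
have Uny : U (n%:R + y + 1) by rewrite -addrA; exact: closed_addn.
rewrite -natr1 -[n%:R + 1 + x]addrAC addrK -[n%:R + 1 + y]addrAC.
have := catT (n%:R + x) (n%:R + y) (n%:R + y + 1) Unx Uny (clU _ Uny).
have := catT (n%:R + x) (n%:R + x) (n%:R + y + 1) Unx (clU _ Unx) (clU _ Uny).
rewrite !diagT // => <- /(canRL (addrK _)) ->; ring.
Qed.

Lemma Cplx_derivable_horner (p : {poly C}) z :
  derivable (horner p : C -> C) z 1.
Proof.
elim/poly_ind: p => [|p c IH].
  rewrite (_ : horner 0 = cst 0); first exact: derivable_cst.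
  by apply/funext => t; rewrite horner0.
have -> : horner (p * 'X + c%:P) = (fun t : C => p.[t] * t) + cst c.
  by apply/funext => t; rewrite !hornerE fctE.
apply: derivableD; last exact: derivable_cst.
by apply: derivableM; [exact: IH | exact: derivable_id].
Qed.

(** Translated functions have as domains sets that are equal, but not
    convertible, to the expected ones; a summation does not see the
    difference. *)
Lemma summation_ext (S : summation R) U V (f : U -> C) (g : V -> C) :
  U = V -> (forall z, U z -> 'valL_0 f z = 'valL_0 g z) -> S U f = S V g.
Proof.
move=> UV; subst V => fg; congr (S U _); apply/funext => u.
rewrite -(valL_val 0 f) -(valL_val 0 g) fg //; exact: set_valP.
Qed.

End Decomposition.

(** * The fractional sum satisfies the axioms *)

Arguments shift_fun {R} s [U] f.

Section FractionalSum.
Variable R : realType.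
Local Notation C := (Cplx R).
Local Notation polyfun p := (sigL setT (horner p)).
Implicit Types (x y z : C) (U : set C).

Lemma fractional_summable_closed U (f : U -> C) :
  fractional_summable f -> forall x, U x -> U (x + 1).
Proof. by case=> k []. Qed.

Lemma fractional_summable_approx U (f : U -> C) : fractional_summable f ->
  exists k p, approximates_le k p f.
Proof. by case=> k [_ [p [/approximatesW pf _]]]; exists k, p. Qed.

Lemma cvg_uniq (u : nat -> C) (a b : C) :
  u n @[n --> \oo] --> a -> u n @[n --> \oo] --> b -> a = b.
Proof.
by move=> /(cvg_lim (@norm_hausdorff _ C)) <- /(cvg_lim (@norm_hausdorff _ C)).
Qed.

Lemma cvgn_cst (a : C) : (fun=> a) n @[n --> \oo] --> a.
Proof. exact: cvg_cst. Qed.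

Lemma cvgn_lin (l m a b : C) (u v : nat -> C) :
  u n @[n --> \oo] --> a -> v n @[n --> \oo] --> b ->
  l * u n + m * v n @[n --> \oo] --> l * a + m * b.
Proof.
move=> ua vb.
have lu : l * u n @[n --> \oo] --> l * a by exact: cvgMl_tmp ua.
have mv : m * v n @[n --> \oo] --> m * b by exact: cvgMl_tmp vb.
by have := cvgD lu mv => /(_ _)/eq_seq_cvg; apply.
Qed.

Lemma fractional_sum_cat U (f : U -> C) x y z : fractional_summable f ->
  U x -> U (y + 1) -> U (z + 1) ->
  fractional_sum f x y + fractional_sum f (y + 1) z = fractional_sum f x z.
Proof.
move=> Ff Ux Uy Uz; have [k [p pf]] := fractional_summable_approx Ff.
apply: cvg_uniq (fractional_sum_seq_cvg Ff pf Ux Uz).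
have := cvgD (fractional_sum_seq_cvg Ff pf Ux Uy)
             (fractional_sum_seq_cvg Ff pf Uy Uz).
move=> /(_ _)/eq_seq_cvg; apply => n.
rewrite /fractional_sum_seq [RHS]addrACA [n%:R + (y + 1)]addrA poly_sum_cat.
rewrite -big_split /=; congr (_ + _); apply: eq_bigr => v _.
by rewrite [v%:R + (y + 1)]addrA addrK; ring.
Qed.

(** The n-th term is p_n(n + x) plus the telescoping sum f(x) - f(n + x), and
    p_n(n + x) - f(n + x) tends to 0. *)
Lemma fractional_sum_diag U (f : U -> C) x : fractional_summable f ->
  U x -> fractional_sum f x x = 'valL_0 f x.
Proof.
move=> Ff Ux; have [k [p pf]] := fractional_summable_approx Ff.
have Ux1 := fractional_summable_closed Ff Ux.
apply: cvg_uniq (fractional_sum_seq_cvg Ff pf Ux Ux1) _.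
have := cvgB (@cvgn_cst ('valL_0 f x)) (pf.2 _ Ux).
rewrite subr0 => /(_ _)/eq_seq_cvg; apply => n.
rewrite !fctE /fractional_sum_seq poly_sum_diag.
rewrite (eq_bigr (fun v =>
  - ('valL_0 f (v.+1%:R + x - 1) - 'valL_0 f (v%:R + x - 1)))).
  rewrite sumrN telescope_sumr // -natr1 addrAC addrK addrAC subrr add0r.
  by rewrite /cst; ring.
move=> v _; rewrite opprB; congr (_ - 'valL_0 f _).
by rewrite -natr1; ring.
Qed.

(** The translates of the approximating polynomials approximate the translate of
    f, and the sequences of both fractional sums are equal. *)
Lemma fractional_sum_shift U (f : U -> C) s : fractional_summable f ->
  fractional_summable (shift_fun s f) /\
  forall x y, U (x + s) -> U (y + s + 1) ->
    fractional_sum f (x + s) (y + s) = fractional_sum (shift_fun s f) x y.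
Proof.
move=> Ff; have clU := fractional_summable_closed Ff.
have [k [p pf]] := fractional_summable_approx Ff.
pose q n := p n \Po ('X + s%:P).
have clV x : shift_dom s U x -> shift_dom s U (x + 1).
  by rewrite /shift_dom /= addrAC; exact: clU.
have shE x : shift_dom s U x -> 'valL_0 (shift_fun s f) x = 'valL_0 f (x + s).
  by move=> Vx; rewrite valL_sigL.
have qf : approximates_le k q (shift_fun s f).
  split=> [n|x Vx]; first by rewrite size_comp_poly2 ?size_XaddC // pf.1.
  have := pf.2 _ Vx => /eq_seq_cvg; apply => n.
  rewrite shE; last exact: closed_addn.
  by rewrite /q horner_comp hornerD hornerX hornerC addrA.
have seqE x y n : U (x + s) -> U (y + s + 1) ->
    fractional_sum_seq q (shift_fun s f) x y n =
    fractional_sum_seq p f (x + s) (y + s) n.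
  move=> Ux Uy; rewrite /fractional_sum_seq poly_sum_shift !addrA.
  congr (_ + _); apply: eq_big_nat => v /andP[v0 _]; rewrite !shE.
  - by congr ('valL_0 f _ - 'valL_0 f _); ring.
  - by apply: closed_addn_pred => //; rewrite /shift_dom /= addrAC.
  - exact: closed_addn_sub1.
have Fg : fractional_summable (shift_fun s f).
  apply: (fractional_summable_le clV qf) => x y Vx Vy.
  have Uy : U (y + s + 1) by rewrite addrAC.
  apply/cvg_ex; exists (fractional_sum f (x + s) (y + s)).
  have := fractional_sum_seq_cvg Ff pf Vx Uy.
  by move=> /eq_seq_cvg; apply => n; exact: seqE.
split=> // x y Ux Uy.
apply: cvg_uniq (fractional_sum_seq_cvg Ff pf Ux Uy) _.
have Vy : shift_dom s U (y + 1) by rewrite /shift_dom /= addrAC.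
have := fractional_sum_seq_cvg Fg qf Ux Vy.
by move=> /eq_seq_cvg; apply => n; rewrite seqE.
Qed.

Lemma fractional_sum_linear U (f g : U -> C) (l m : C) :
  fractional_summable f -> fractional_summable g ->
  fractional_summable (fun u => l * f u + m * g u) /\
  forall x y, U x -> U (y + 1) ->
    fractional_sum (fun u => l * f u + m * g u) x y =
    l * fractional_sum f x y + m * fractional_sum g x y.
Proof.
move=> Ff Fg; have clU := fractional_summable_closed Ff.
have [k [p pf]] := fractional_summable_approx Ff.
have [k' [q qg]] := fractional_summable_approx Fg.
set h : U -> C := fun u => _.
have hE x : U x -> 'valL_0 h x = l * 'valL_0 f x + m * 'valL_0 g x.
  by move=> Ux; have [u _ uE] := valLP (0 : C) Ux; rewrite !uE.
pose r n := l *: p n + m *: q n.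
have rh : approximates_le (maxn k k') r h.
  split=> [n|x Ux].
    apply: leq_trans (size_polyD _ _) _; rewrite geq_max !leq_max.
    rewrite (leq_trans (size_scale_leq _ _) (pf.1 n)).
    by rewrite (leq_trans (size_scale_leq _ _) (qg.1 n)) orbT.
  have := cvgn_lin (l := l) (m := m) (pf.2 _ Ux) (qg.2 _ Ux).
  rewrite !mulr0 addr0 => /eq_seq_cvg; apply => n.
  rewrite hE; last exact: closed_addn.
  by rewrite hornerD !hornerZ; ring.
have seqE x y n : U x -> U (y + 1) -> fractional_sum_seq r h x y n =
    l * fractional_sum_seq p f x y n + m * fractional_sum_seq q g x y n.
  move=> Ux Uy; rewrite /fractional_sum_seq poly_sum_lin.
  set sh := \sum_(1 <= v < n.+1) _; set sf := \sum_(1 <= v < n.+1) _.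
  set sg := \sum_(1 <= v < n.+1) _.
  suff -> : sh = l * sf + m * sg by ring.
  rewrite !mulr_sumr -big_split.
  apply: eq_big_nat => v /andP[v0 _]; rewrite !hE.
  - by rewrite opprD addrACA -!mulrBr.
  - exact: closed_addn_pred.
  - exact: closed_addn_sub1.
have cvgr x y : U x -> U (y + 1) ->
    fractional_sum_seq r h x y n @[n --> \oo] -->
    l * fractional_sum f x y + m * fractional_sum g x y.
  move=> Ux Uy.
  have := cvgn_lin (l := l) (m := m) (fractional_sum_seq_cvg Ff pf Ux Uy)
    (fractional_sum_seq_cvg Fg qg Ux Uy).
  by move=> /eq_seq_cvg; apply => n; rewrite seqE.
have Fh : fractional_summable h.
  apply: (fractional_summable_le clU rh) => x y Ux Uy.
  by apply/cvg_ex; eexists; exact: cvgr.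
split=> // x y Ux Uy.
exact: cvg_uniq (fractional_sum_seq_cvg Fh rh Ux Uy) (cvgr _ _ Ux Uy).
Qed.

(** With the constant approximating sequence p, the defining sequence is
    constant, by the decomposition of polynomial sums. *)
Lemma fractional_sum_poly (p : {poly C}) :
  fractional_summable (polyfun p) /\
  forall x y, fractional_sum (polyfun p) x y = poly_sum p x y.
Proof.
have pp : approximates_le (size p) (fun=> p) (polyfun p).
  split=> // x _.
  have /eq_seq_cvg := @cvgn_cst (0 : C); apply => n.
  by rewrite valL_sigL // subrr.
have seqE x y n :
    fractional_sum_seq (fun=> p) (polyfun p) x y n = poly_sum p x y.
  rewrite /fractional_sum_seq.
  rewrite [RHS](@shift_decomposition _ _ (horner p) setT _ _ _ _ _ n) //.
  - by congr (_ + _); apply: eq_bigr => v _; rewrite !valL_sigL.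
  - by move=> *; exact: poly_sum_cat.
  - by move=> *; exact: poly_sum_diag.
have cv x y : fractional_sum_seq (fun=> p) (polyfun p) x y n @[n --> \oo] -->
    poly_sum p x y.
  have /eq_seq_cvg := @cvgn_cst (poly_sum p x y); apply => n.
  exact: seqE.
have Fp : fractional_summable (polyfun p).
  apply: (fractional_summable_le _ pp) => [//|x y _ _].
  by apply/cvg_ex; eexists; exact: cv.
split=> // x y.
exact: cvg_uniq (fractional_sum_seq_cvg Fp pp _ _) (cv _ _).
Qed.

Lemma fractional_sum_decomposition U (f : U -> C) x y (n : nat) :
  fractional_summable f -> U x -> U (y + 1) ->
  fractional_sum f x y = fractional_sum f (n%:R + x) (n%:R + y) +
    \sum_(1 <= v < n.+1) ('valL_0 f (v%:R + x - 1) - 'valL_0 f (v%:R + y)).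
Proof.
move=> Ff; apply: (shift_decomposition (fractional_summable_closed Ff)).
  by move=> *; exact: fractional_sum_cat.
by move=> *; exact: fractional_sum_diag.
Qed.

Lemma polyfun_shift (p : {poly C}) (s : C) :
  sigL setT (fun z => p.[z + s]) = polyfun (p \Po ('X + s%:P)).
Proof.
by congr (sigL _ _); apply/funext => z; rewrite horner_comp !hornerE.
Qed.

Lemma polyfunXn (d : nat) : sigL setT (fun z : C => z ^+ d) = polyfun 'X^d.
Proof. by congr (sigL _ _); apply/funext => z; rewrite hornerXn. Qed.

Lemma approximates_le_shifted (k : nat) (p : nat -> {poly C}) U (f : U -> C) :
  (forall n, size (p n) = k) ->
  (forall z, U z ->
    `|'valL_0 f (z + n%:R) - (p n).[z + n%:R]| @[n --> \oo] --> (0 : C)) ->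
  approximates_le k p f.
Proof.
move=> sp pf; split=> [n|x Ux]; first by rewrite sp.
have /norm_cvg0P := pf _ Ux.
by move=> /eq_seq_cvg; apply => n; rewrite [n%:R + x]addrC.
Qed.

(** By translation and decomposition, the difference of the two sums is the
    fractional sum of f minus the n-th term of the sequence converging to
    it. *)
Lemma fractional_sum_right_shift U (f : U -> C) (k : nat)
    (p : nat -> {poly C}) x y :
  fractional_summable f -> approximates_le k p f -> U x -> U (y + 1) ->
  `|fractional_sum (shift_fun n%:R f) x y -
    fractional_sum (sigL setT (fun z => (p n).[z + n%:R])) x y|
    @[n --> \oo] --> (0 : C).
Proof.
move=> Ff pf Ux Uy; apply/norm_cvg0P.
have := cvgB (@cvgn_cst (fractional_sum f x y))
             (fractional_sum_seq_cvg Ff pf Ux Uy).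
rewrite subrr => /(_ _)/eq_seq_cvg; apply => n.
have clU := fractional_summable_closed Ff.
rewrite fctE /cst (fractional_sum_decomposition n Ff Ux Uy) /fractional_sum_seq.
rewrite polyfun_shift (fractional_sum_poly _).2 poly_sum_shift.
rewrite -(fractional_sum_shift n%:R Ff).2 ![_ + n%:R]addrC; first by ring.
  exact: closed_addn.
by rewrite -addrA; exact: closed_addn.
Qed.

Lemma fractional_sum_axioms :
  summation_axioms (@fractional_summable R) (@fractional_sum R).
Proof.
split.
- by move=> U f Ff x y z; exact: fractional_sum_cat.
- by move=> U f Ff s; exact: fractional_sum_shift.
- by move=> U f g Ff Fg l m; exact: fractional_sum_linear.
- by move=> U f Ff U1; exact: fractional_sum_diag.
- move=> d; rewrite polyfunXn; have [Fp sumE] := fractional_sum_poly 'X^d.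
  split=> // z; rewrite (_ : fractional_sum _ _ =
    (horner (poly_antidiff 'X^d - ((poly_antidiff 'X^d).[1 - 1])%:P))).
    exact: Cplx_derivable_horner.
  by apply/funext => t; rewrite sumE hornerD hornerN hornerC.
- move=> U f Ff f0 x y Ux Uy.
  have f_le : approximates_le 0 (fun=> 0) f.
    apply: approximates_le_shifted => [n|z Uz]; first by rewrite size_poly0.
    apply/norm_cvg0P; have := f0 _ Uz.
    by move=> /eq_seq_cvg; apply => n; rewrite horner0 subr0.
  have /norm_cvg0P := fractional_sum_right_shift Ff f_le Ux Uy.
  move=> /eq_seq_cvg; apply => n.
  rewrite polyfun_shift comp_poly0 (fractional_sum_poly _).2.
  by rewrite poly_sum0 subr0.
- move=> U f Ff k p sp pf x y Ux Uy.
  by apply: fractional_sum_right_shift => //; exact: approximates_le_shifted.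
Qed.

End FractionalSum.

(** * Uniqueness *)

Section Uniqueness.
Variable R : realType.
Local Notation C := (Cplx R).
Local Notation polyfun p := (sigL setT (horner p)).
Implicit Types (p q : {poly C}) (x y z : C) (U : set C).

Lemma cvg_harmonic_dnbhs (w : C) : w != 0 ->
  w / n.+1%:R @[n --> \oo] --> (0 : C)^'.
Proof.
move=> w0; have h : w / n.+1%:R @[n --> \oo] --> (0 : C).
  by rewrite -[X in _ --> X](mulr0 w);
    apply: (cvgMl_tmp (@Cplx_cvg_harmonic R)).
move=> A A0; apply: (@filterS _ \oo _ _ _ _ (h _ A0)) => n; apply.
by rewrite mulf_neq0 // invr_eq0 pnatr_eq0.
Qed.

(** Additivity makes the difference quotient of h at 0 constant, equal to
    h(w) / w, along the sequence w / (n + 1). So h(w) / w is the derivative at 0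
    for every w != 0; its value at w = 1 is 0. *)
Lemma additive_derivable_eq0 (h : C -> C) : {morph h : x y / x + y} ->
  derivable h 0 1 -> h 1 = 0 -> forall z, h z = 0.
Proof.
move=> hD /cvg_ex[l hl] h1.
have h0 : h 0 = 0 by apply: (addrI (h 0)); rewrite -hD !addr0.
have hn z (n : nat) : h (n%:R * z) = n%:R * h z.
  elim: n => [|n IH]; first by rewrite !mul0r.
  by rewrite -natr1 !mulrDl !mul1r hD IH.
have slope w : w != 0 -> w^-1 * h w = l.
  move=> w0; have := cvg_comp _ _ (cvg_harmonic_dnbhs w0) hl.
  apply: cvg_uniq; move: (@cvgn_cst R (w^-1 * h w)) => /eq_seq_cvg; apply => n.
  rewrite /= addr0 h0 subr0 [_ *: 1]mulr1.
  have -> : h w = n.+1%:R * h (w / n.+1%:R).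
    by rewrite -hn mulrC divfK ?pnatr_eq0.
  by rewrite invfM invrK [RHS]mulrA.
have l0 : l = 0 by rewrite -(slope 1) ?oner_neq0 // h1 mulr0.
move=> z; have [-> //|z0] := eqVneq z 0.
by apply: (mulfI (invr_neq0 z0)); rewrite slope // l0 mulr0.
Qed.

Section GivenSummation.
Variables (S : summation R).
Hypothesis SA : summation_axioms (@fractional_summable R) S.
Let T p x y := S (polyfun p) x y.

(** Translation by x - 1 reduces this to the one-term sum from 1 to 1. *)
Lemma summation_diag U (f : U -> C) x : fractional_summable f -> U x ->
  S f x x = 'valL_0 f x.
Proof.
move=> Ff Ux; have [Fs shE] := translation_invariance SA Ff (x - 1).
have E : 1 + (x - 1) = x by rewrite addrC subrK.
have U1 : shift_dom (x - 1) U 1 by rewrite /shift_dom /= E.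
have := shE 1 1; rewrite E => -> //.
  by rewrite (classical_consistency SA Fs U1) valL_sigL // E.
exact: (fractional_summable_closed Ff).
Qed.

Lemma summation_poly_shift p s x y :
  T p (x + s) (y + s) = T (p \Po ('X + s%:P)) x y.
Proof.
have [Fs shE] := translation_invariance SA (fractional_sum_poly p).1 s.
rewrite /T shE //; congr (_ x y); apply: summation_ext => // z Vz.
by rewrite !valL_sigL // horner_comp hornerD hornerX hornerC.
Qed.

Lemma summation_poly_lin p q (a b : C) x y :
  T (a *: p + b *: q) x y = a * T p x y + b * T q x y.
Proof.
have [_ lin] := linearity SA (fractional_sum_poly p).1
  (fractional_sum_poly q).1 a b.
rewrite /T -lin //; congr (_ x y); apply: summation_ext => // z Vz.
have [u zu uE] := valLP (0 : C) Vz.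
by rewrite !uE /sigL /= -zu hornerD !hornerZ.
Qed.

Lemma summation_poly_cat p x y z : T p x y + T p (y + 1) z = T p x z.
Proof. exact: (continued_summation SA (fractional_sum_poly p).1). Qed.

(** The induction is on a bound for the size of p; by linearity only the new
    monomial 'X^k matters, and by continued summation only its sums from 1. *)
Lemma summation_poly p x y : T p x y = poly_sum p x y.
Proof.
have TD r t u v : T (r + t) u v = T r u v + T t u v.
  by have := summation_poly_lin r t 1 1 u v; rewrite !scale1r !mul1r.
have TZ a r u v : T (a *: r) u v = a * T r u v.
  by have := summation_poly_lin r 0 a 0 u v; rewrite scale0r addr0 mul0r addr0.
have [k] := ubnP (size p); elim: k => // k IH in p x y *; rewrite ltnS => sp.
case: k => [|k] in IH sp *.
  move: sp; rewrite leqn0 size_poly_eq0 => /eqP ->.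
  by rewrite -(scale0r 0) TZ poly_sumZ !mul0r.
suff X_k u v : T 'X^k u v = poly_sum 'X^k u v.
  rewrite -[p](subrK (p`_k *: 'X^k)) TD TZ poly_sumD poly_sumZ X_k IH //.
  by apply: size_sub_lead; rewrite ?monicXn ?size_polyXn.
pose h z := T 'X^k 1 z - poly_sum 'X^k 1 z.
suff h0 z : h z = 0.
  have := summation_poly_cat 'X^k 1 (u - 1) v.
  have := poly_sum_cat 'X^k 1 (u - 1) v.
  have /eqP := h0 v; have /eqP := h0 (u - 1); rewrite !subr_eq0 subrK.
  by move=> /eqP -> /eqP -> <- /addrI.
apply: additive_derivable_eq0.
- move=> a b; rewrite /h -(summation_poly_cat _ 1 a) -(poly_sum_cat _ 1 a).
  rewrite [a + 1]addrC [a + b]addrC summation_poly_shift -poly_sum_shift.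
  set q := _ \Po _.
  (* The translate of 'X^k by a is monic of the same degree, so it differs
     from 'X^k by a polynomial covered by the induction hypothesis. *)
  have sq : (size (q - 'X^k)%R <= k)%N.
    have mq : q \is monic.
      by rewrite /q comp_Xn_poly monic_exp // monicXaddC.
    apply: size_sub_monic => //; rewrite ?monicXn ?size_polyXn //.
    by rewrite /q comp_Xn_poly -[a](opprK a) polyCN size_exp_XsubC.
  by rewrite -[q](subrK 'X^k) TD poly_sumD (IH (q - 'X^k)) //; ring.
- have := (holomorphic_monomials SA k).2 0; rewrite polyfunXn => dT.
  have dP := @Cplx_derivable_horner R
    (poly_antidiff 'X^k - ((poly_antidiff 'X^k).[1 - 1])%:P) 0.
  have -> : h = (S (polyfun 'X^k) 1 : C -> C) - horner
      (poly_antidiff 'X^k - ((poly_antidiff 'X^k).[1 - 1])%:P).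
    by apply/funext => t; rewrite !fctE hornerD hornerN hornerC.
  exact: (derivableB dT dP).
- have X1 : S (polyfun 'X^k) 1 1 = 1.
    rewrite (classical_consistency SA (fractional_sum_poly _).1) //.
    by rewrite valL_sigL // hornerXn expr1n.
  by rewrite /h /T X1 poly_sum_diag hornerXn expr1n subrr.
Qed.

(** After decomposition of S f and evaluation of S on polynomials, right shift
    continuity says that the sequence defining the fractional sum tends to
    S f. *)
Lemma summation_unique U (f : U -> C) x y : fractional_summable f ->
  U x -> U (y + 1) -> S f x y = fractional_sum f x y.
Proof.
move=> Ff Ux Uy; case: (Ff) => k [clU [p [pf _]]].
have pf' z : U z ->
    `|'valL_0 f (z + n%:R) - (p n).[z + n%:R]| @[n --> \oo] --> (0 : C).
  by move=> /pf.2/eq_seq_cvg; apply => n; rewrite [z + _]addrC.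
have lim0 := right_shift_continuity SA Ff pf.1 pf' Ux Uy.
apply: cvg_uniq (fractional_sum_seq_cvg Ff (approximatesW pf) Ux Uy).
have /norm_cvg0P d0 := lim0.
have := cvgB (@cvgn_cst R (S f x y)) d0; rewrite subr0.
move=> /(_ _)/eq_seq_cvg; apply => n.
rewrite fctE (_ : S f x y = S f (n%:R + x) (n%:R + y) +
  \sum_(1 <= v < n.+1) ('valL_0 f (v%:R + x - 1) - 'valL_0 f (v%:R + y))).
  rewrite polyfun_shift [S (polyfun _) x y]summation_poly poly_sum_shift.
  have [_ shE] := translation_invariance SA Ff n%:R.
  rewrite -shE ![_ + n%:R]addrC; first by rewrite /fractional_sum_seq; ring.
    exact: closed_addn.
  by rewrite -addrA; exact: closed_addn.
apply: (shift_decomposition clU) => //.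
  by move=> *; exact: (continued_summation SA Ff).
by move=> *; exact: summation_diag.
Qed.

End GivenSummation.
End Uniqueness.

Theorem theorem1p3 (R : realType) :
  summation_axioms (@fractional_summable R) (@fractional_sum R) /\
  forall S : summation R, summation_axioms (@fractional_summable R) S ->
    forall (U : set (Cplx R)) (f : U -> Cplx R), fractional_summable f ->
    forall x y : Cplx R, U x -> U (y + 1) ->
      S U f x y = fractional_sum f x y.
Proof.
split; first exact: fractional_sum_axioms.
by move=> S SA U f Ff x y; exact: summation_unique.
Qed.
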